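(* Let $\mathrm{Peak}_{\mathcal N_2(0)}(t)=1$ and, for $n\ge1$, let $\mathrm{Peak}_{\mathcal N_2(n)}(t)=\sum t^{\mathrm{peak}(\mathbf a)}$, the sum being over all area sequences $\mathbf a$ of size $n$ with $\mathrm{pnest}(\mathbf a)\le2$. Then $\mathrm{Peak}_{\mathcal N_2(1)}(t)=t$, $\mathrm{Peak}_{\mathcal N_2(2)}(t)=t+t^2$, and for $n\ge3$ $$\mathrm{Peak}_{\mathcal N_2(n)}(t)=2(t+1)\,\mathrm{Peak}_{\mathcal N_2(n-1)}(t)-(1+t+t^2)\,\mathrm{Peak}_{\mathcal N_2(n-2)}(t).$$ Moreover, $\mathrm{Peak}_{\mathcal N_2(n)}(t)$ is real-rooted for every $n\ge0$ and $\{\mathrm{Peak}_{\mathcal N_2(n)}(t)\}_{n\ge0}$ is a Sturm sequence.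
   Context: Write $[n]=\{1,\dots,n\}$. An area sequence of size $n$ is a sequence $\mathbf a=(a_1,\dots,a_n)$ of nonnegative integers with $a_i<i$ for all $i$ and $a_i\le a_{i-1}+1$ for all $i\ge 2$. It defines a graph $\Gamma_{\mathbf a}$ (a unit interval graph) on $[n]$ with edges $\{j,i\}$ for $1\le j<i\le n$ with $i-a_i\le j$. If $\{i,j\}$ with $i<j$ is an edge then $\{i,i+1,\dots,j\}$ is a clique. A peak-edge of $\Gamma_{\mathbf a}$ is either an isolated vertex $i$ (put $j=i$) or an edge $\{i,j\}$, $i<j$, such that neither $\{i,j+1\}$ nor $\{i-1,j\}$ is an edge (pairs not contained in $[n]$ are not edges). The corresponding peak-clique is $\{i,\dots,j\}$. The number of peak-edges is $\mathrm{peak}(\mathbf a)$. The peak-nesting of a vertex is the number of peak-cliques containing it, and $\mathrm{pnest}(\mathbf a)$ is the maximum over all vertices. A real polynomial is real-rooted if all its zeros are real (constants are real-rooted). For real-rooted $f,g$ with positive leading coefficients and zeros (with multiplicity) $\cdots\le\lambda_2\le\lambda_1$ and $\cdots\le\delta_2\le\delta_1$ respectively, write $g\ll f$ if $\cdots\le\delta_2\le\lambda_2\le\delta_1\le\lambda_1$ (so the degrees differ by at most one, $\deg g\le\deg f$). A sequence $\{f_i\}_{i\ge0}$ of real-rooted polynomials with positive leading coefficients is a Sturm sequence if $f_{i-1}\ll f_i$ for all $i\ge1$ and $\deg f_i=i$ for all $i\ge0$. *)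

(* Defs.v *)
From mathcomp Require Import all_boot all_order all_algebra.
From mathcomp Require Import reals.
From mathcomp Require Export complex.

Set Implicit Arguments.
Unset Strict Implicit.
Unset Printing Implicit Defensive.

Import Order.TTheory GRing.Theory Num.Theory.

(* The vertex set [n] = {1, ..., n} is encoded by 'I_n: the ordinal i stands
   for the vertex i + 1, and a i for the entry a_{i+1}. *)
Section AreaSequences.
Variable n : nat.

(* The condition a_{i+1} < i + 1 bounds all the entries by n - 1, so taking
   them in 'I_n loses nothing and makes the set of area sequences finite. *)
Definition area_sequence (a : {ffun 'I_n -> 'I_n}) : bool :=
  [forall i : 'I_n, a i <= i] &&
  [forall i : 'I_n, forall j : 'I_n, (j == i.+1 :> nat) ==> (a j <= (a i).+1)].

Variable a : {ffun 'I_n -> 'I_n}.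

(* v - a_v <= u, without truncated subtraction *)
Definition ui_edge : rel 'I_n := fun u v =>
  (u < v) && (v <= u + a v) || (v < u) && (u <= v + a u).

Definition isolated (v : 'I_n) : bool := [forall u : 'I_n, ~~ ui_edge v u].

(* Quantifying over k : 'I_n makes {i, j + 1} and {i - 1, j} non-edges when
   they are not contained in [n]. *)
Definition peak_edge (e : 'I_n * 'I_n) : bool :=
  let: (i, j) := e in
  (i == j) && isolated i ||
  [&& i < j, ui_edge i j,
      ~~ [exists k : 'I_n, (k == j.+1 :> nat) && ui_edge i k] &
      ~~ [exists k : 'I_n, (k.+1 == i) && ui_edge k j]].

Definition peak_clique (e : 'I_n * 'I_n) : {set 'I_n} :=
  [set v : 'I_n | e.1 <= v <= e.2].

Definition peak : nat := #|[set e | peak_edge e]|.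

Definition peak_nesting (v : 'I_n) : nat :=
  #|[set e | peak_edge e & v \in peak_clique e]|.

Definition pnest : nat := \max_(v : 'I_n) peak_nesting v.

End AreaSequences.

Local Open Scope ring_scope.

Definition PeakN2 (R : nzRingType) (n : nat) : {poly R} :=
  if n is 0 then 1
  else \sum_(a : {ffun 'I_n -> 'I_n} | area_sequence a && (pnest a <= 2)%N)
         'X^(peak a).

Section RealRooted.
Variable R : realType.

(* The first alternative covers the constants, including the zero polynomial. *)
Definition real_rooted (p : {poly R}) : Prop :=
  (size p <= 1)%N \/
  forall z : R[i], root (map_poly (real_complex R) p) z -> complex.Im z = 0.

Definition decreasing_zeros (p : {poly R}) (s : seq R) : Prop :=
  sorted (fun x y : R => y <= x) s /\ forall x : R, count_mem x s = mup x p.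

(* g << f; for nonzero f and g the lists lambda and delta are unique. *)
Definition interlaces (g f : {poly R}) : Prop :=
  [/\ real_rooted g /\ 0 < lead_coef g,
      real_rooted f /\ 0 < lead_coef f &
      exists delta lambda : seq R,
        [/\ decreasing_zeros g delta,
            decreasing_zeros f lambda,
            (size delta <= size lambda <= (size delta).+1)%N,
            forall i, (i < size delta)%N -> delta`_i <= lambda`_i &
            forall i, (i.+1 < size lambda)%N -> lambda`_i.+1 <= delta`_i]].

Definition Sturm_sequence (f : nat -> {poly R}) : Prop :=
  [/\ forall i, real_rooted (f i) /\ 0 < lead_coef (f i),
      forall i, interlaces (f i) (f i.+1) &
      forall i, size (f i) = i.+1].

End RealRooted.

(* Main.v *)
(* Let l(v) = v - a_v be the least vertex of the clique ending at v.  The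
   peak-cliques are the intervals [l(v), v] for which v is last or l(v+1) > l(v),
   and the nesting is at most 2 iff each new value of l is at least the start of
   the preceding maximal run of vertices with constant l.  Reading the entries of
   a from left to right, the state (previous entry x, number g of entries that
   may start a new run) determines the admissible continuations: x + 1, with
   g -> g + 1, or y < g, with g -> 1 if y = 0 and g -> 2 otherwise.  The generating
   function of the continuations is therefore affine in g, and its two
   coefficients evolve by a 2 x 2 matrix of trace 2(t + 1) and determinant
   1 + t + t^2.

   Writing Peak_(n+1) = t q_n, one has q_n(0) = 1, and since 1 + t + t^2 > 0 the
   values of q_(n+2) and q_n at each zero of q_(n+1) have opposite signs.  By
   induction the intermediate value theorem places one zero of q_(n+2) in each of
   the intervals cut out by 0, the zeros of q_(n+1) and -oo. *)

Require Import Defs.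
From mathcomp Require Import all_boot all_order all_algebra.
From mathcomp Require Import reals.
From mathcomp Require Import polyrcf.
From mathcomp Require Import zify ring lra.

Set Implicit Arguments.
Unset Strict Implicit.
Unset Printing Implicit Defensive.

Import Order.TTheory GRing.Theory Num.Theory.
Local Open Scope ring_scope.

(** * Words read as runs of a two-parameter state machine *)

Section Words.
Local Open Scope nat_scope.

(* [k] is the right end of a peak-clique; for the last vertex this relies
   on the default value [0] of [area_fun] past the end. *)
Definition brk (A : nat -> nat) (k : nat) : bool := A k.+1 != (A k).+1.

Fixpoint runs (x : nat) (s : seq nat) : nat :=
  if s is y :: s' then (y != x.+1) + runs y s' else 0.

(** After a break leading to the entry [y], a further new run must start beyond the break just made,
    so its entry is at most [1], and it is at most [y]: this leaves [(0 < y).+1] choices. *)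
Fixpoint accept (x g : nat) (s : seq nat) : bool :=
  if s is y :: s' then
    if y == x.+1 then accept y g.+1 s' else (y < g) && accept y (0 < y).+1 s'
  else true.

Fixpoint gap (A : nat -> nat) (k : nat) : nat :=
  if k is k'.+1 then if brk A k' then (0 < A k).+1 else (gap A k').+1 else 1.

Fixpoint words (m x g : nat) : seq (seq nat) :=
  if m is m'.+1 then
    [seq x.+1 :: s | s <- words m' x.+1 g.+1] ++
    [seq y :: s | y <- iota 0 g, s <- words m' y (0 < y).+1]
  else [:: [::]].

(** The bound [g <= x.+1] keeps [x.+1] out of [iota 0 g], so the two branches of [words] are
    disjoint; both transitions preserve it. *)
Lemma mem_words m x g s : g <= x.+1 ->
  (s \in words m x g) = (size s == m) && accept x g s.
Proof.
elim: m x g s => [|m IHm] x g s le_gx /=; first by case: s.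
rewrite mem_cat; apply/orP/andP => [[/mapP[s']|/allpairsPdep[y [s']]]|[]].
- by rewrite IHm // => /andP[/eqP <- acc] ->; rewrite /= !eqxx.
- case; rewrite mem_iota add0n => /= lt_yg; rewrite IHm; last by case: (y) lt_yg.
  move=> /andP[/eqP <- acc] -> /=; rewrite eqxx ltn_eqF ?lt_yg //.
  exact: leq_trans lt_yg _.
case: s => // y s; rewrite eqSS => sz_s /=.
case: eqP => [-> acc|_ /andP[lt_yg acc]]; [left|right].
  by apply: map_f; rewrite IHm // sz_s acc.
apply/allpairsPdep; exists y, s; split; rewrite ?mem_iota //.
by rewrite IHm ?sz_s //; case: (y).
Qed.

Lemma words_uniq m x g : g <= x.+1 -> uniq (words m x g).
Proof.
elim: m x g => [//|m IHm] x g le_gx /=.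
rewrite cat_uniq map_inj_uniq ?IHm //=; last by move=> ? ? [].
apply/andP; split.
  apply/hasPn => s /allpairsPdep[y [s' [+ _ ->]]].
  rewrite mem_iota => /= lt_yg; apply/mapP => -[s'' _ [eq_y _]]; lia.
apply: allpairs_uniq_dep; first exact: iota_uniq.
  by move=> y _; apply: IHm; case: y.
by move=> [y s] [y' s'] _ _ /= [-> ->].
Qed.

Lemma runsE A k m :
  runs (A k) [seq A i | i <- iota k.+1 m] = count (brk A) (iota k m).
Proof. by elim: m k => //= m IHm k; rewrite IHm. Qed.

Lemma acceptE A k m :
  accept (A k) (gap A k) [seq A i | i <- iota k.+1 m] =
  all (fun i => brk A i ==> (A i.+1 < gap A i)) (iota k m).
Proof.
elim: m k => //= m IHm k; rewrite -IHm /= /brk.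
by case: eqP.
Qed.

Lemma gap_le A k : gap A k <= (A k).+1.
Proof.
elim: k => //= k IHk; rewrite /brk; case: eqP => [-> //|_].
by case: (A _).
Qed.

(* Entry [y] at [k.+1] gives the left end [k.+1 - y]; it must avoid every
   peak-clique other than the one ending at [k], i.e. exceed their right ends. *)
Lemma gapP A k y : (forall i, A i.+1 <= (A i).+1) -> A 0 = 0 -> y <= A k ->
  reflect (forall w, w < k -> brk A w -> w + y <= k) (y < gap A k).
Proof.
move=> areaA A0; elim: k y => [|k IHk] y le_yA /=.
  by rewrite A0 in le_yA; rewrite ltnS le_yA; left.
have [bk|] := boolP (brk A k).
  have [le_y1|gt_y1] := leqP y 1.
    have -> : y < (0 < A k.+1).+1 by case: (A k.+1) le_yA; lia.
    by left => w lt_wk _; lia.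
  have -> : (y < (0 < A k.+1).+1) = false by case: (A k.+1) le_yA; lia.
  by right => /(_ k (ltnSn k) bk); lia.
move=> nbk; have eqA : A k.+1 = (A k).+1 by apply/eqP; rewrite negbK in nbk.
(* Without a break at [k], raising [k] and [y] together leaves the inequality unchanged, and the
   extra candidate [w = k] is not a break. *)
case: y le_yA => [_|y le_yA].
  by left => w lt_wk _; lia.
rewrite ltnS; have le_yk : y <= A k by lia.
apply: (iffP (IHk y le_yk)) => H w lt_wk bw.
  have [eq_wk|lt_wk'] : w = k \/ w < k by lia.
    by rewrite eq_wk (negPf nbk) in bw.
  by have := H w lt_wk' bw; lia.
by have := H w (ltnW lt_wk) bw; lia.
Qed.

End Words.

(** * Peak-cliques and nesting in terms of breaks *)

Section AreaWord.
Local Open Scope nat_scope.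
Variables (m : nat) (a : {ffun 'I_m.+1 -> 'I_m.+1}).

Definition area_word : seq nat := [seq val (a i) | i <- enum 'I_m.+1].

Definition area_fun (k : nat) : nat := nth 0 area_word k.

Local Notation A := area_fun.

Lemma size_area_word : size area_word = m.+1.
Proof. by rewrite size_map size_enum_ord. Qed.

Lemma area_funE (i : 'I_m.+1) : A i = a i.
Proof.
rewrite /area_fun (nth_map i) ?size_enum_ord ?ltn_ord //.
by rewrite nth_ord_enum.
Qed.

Lemma area_fun_default k : m < k -> A k = 0.
Proof. by move=> lt_mk; rewrite /A nth_default // size_area_word. Qed.

Lemma area_word_iota : area_word = [seq A i | i <- iota 0 m.+1].
Proof. by rewrite -[LHS](mkseq_nth 0) size_area_word. Qed.

Lemma brk_last : brk A m.
Proof. by rewrite /brk area_fun_default. Qed.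

(** The default value [0] past the end makes the step inequality hold there, so it can range over
    all [k]. *)
Lemma area_sequenceP :
  reflect (A 0 = 0 /\ forall k, A k.+1 <= (A k).+1) (area_sequence a).
Proof.
apply: (iffP andP) => [[/forallP le_a /forallP step]|[A0 step]].
  split=> [|k].
    by have := le_a ord0; rewrite -area_funE /= leqn0 => /eqP.
  have [lt_km|le_mk] := ltnP k.+1 m.+1; last by rewrite area_fun_default.
  have /forallP/(_ (Ordinal lt_km))/implyP/(_ (eqxx _)) :=
    step (Ordinal (ltnW lt_km)).
  by rewrite -!area_funE.
have le_A k : A k <= k by elim: k => [|k IHk]; rewrite ?A0 // (leq_trans (step k)).
split; first by apply/forallP => i; rewrite -area_funE le_A.
apply/forallP => i; apply/forallP => j; apply/implyP => /eqP eq_j.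
by rewrite -!area_funE eq_j.
Qed.

Hypothesis areaA : area_sequence a.

Let A0 : A 0 = 0. Proof. by have /area_sequenceP[] := areaA. Qed.
Let stepA k : A k.+1 <= (A k).+1.
Proof. by have /area_sequenceP[] := areaA. Qed.

Lemma area_fun_le k : A k <= k.
Proof. by elim: k => [|k IHk]; rewrite ?A0 // (leq_trans (stepA k)). Qed.

(* [i - A i] is nondecreasing. *)
Lemma area_fun_mono i u : i <= u -> i + A u <= u + A i.
Proof.
move=> le_iu; rewrite -(subnKC le_iu); elim: (u - i) => [|d IHd].
  by rewrite addn0.
by have := stepA (i + d); rewrite addnS; lia.
Qed.

Lemma ui_edge_ltE (i j : 'I_m.+1) : i < j -> ui_edge a i j = (j <= i + A j).
Proof.
by move=> lt_ij; rewrite /ui_edge lt_ij /= -area_funE ltnNge (ltnW lt_ij) orbF.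
Qed.

Lemma ui_edge_sym (i j : 'I_m.+1) : ui_edge a i j = ui_edge a j i.
Proof. by rewrite /ui_edge orbC. Qed.

(** Cliques fill intervals, so a vertex with an edge is adjacent to its predecessor or its
    successor; the default [0] settles the last vertex. *)
Lemma isolatedE (i : 'I_m.+1) : isolated a i = (A i == 0) && (A i.+1 == 0).
Proof.
apply/forallP/andP => [iso|[/eqP Ai0 /eqP Ai1] u].
  have Ai0 : A i = 0.
    case E : (A i) => [//|b]; have le_Ai := area_fun_le i.
    have lt_i : i.-1 < m.+1 by have := ltn_ord i; lia.
    have := iso (Ordinal lt_i); rewrite ui_edge_sym ui_edge_ltE /=; lia.
  rewrite Ai0; split=> //; have [lt_im|le_mi] := ltnP i.+1 m.+1.
    have := iso (Ordinal lt_im); rewrite ui_edge_ltE /=; last by lia.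
    by lia.
  by rewrite area_fun_default.
have [lt_iu|lt_ui|/val_inj ->] := ltngtP i u.
- rewrite ui_edge_ltE //; have := area_fun_mono lt_iu; lia.
- rewrite ui_edge_sym ui_edge_ltE //; lia.
- by rewrite /ui_edge ltnn.
Qed.

(** That [{i - 1, j}] is no edge pins [i] to the left end [j - A j]; that [{i, j + 1}] is none then
    makes [j] a break. Isolated vertices are the case [A j = 0]. *)
Lemma peak_edgeE (i j : 'I_m.+1) :
  peak_edge a (i, j) = brk A j && (j == i + A j :> nat).
Proof.
rewrite /peak_edge /brk isolatedE.
have [eq_ij|ne_ij] := eqVneq i j.
  rewrite eq_ij ltnn /= orbF; have := stepA j; lia.
have [lt_ij|lt_ji|/val_inj eq_ij] := ltngtP i j; last by rewrite eq_ij eqxx in ne_ij.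
  rewrite /= ui_edge_ltE //.
  have -> : [exists k : 'I_m.+1, (k == j.+1 :> nat) && ui_edge a i k] =
            (j.+1 <= i + A j.+1).
    apply/existsP/idP => [[k /andP[/eqP eq_k]]|le_j].
      by rewrite ui_edge_ltE ?eq_k //; lia.
    have [lt_jm|le_mj] := ltnP j.+1 m.+1; last by rewrite area_fun_default in le_j; lia.
    by exists (Ordinal lt_jm); rewrite ui_edge_ltE /= ?eqxx //; lia.
  have -> : [exists k : 'I_m.+1, (k.+1 == i :> nat) && ui_edge a k j] =
            (j < i + A j).
    apply/existsP/idP => [[k /andP[/eqP eq_k]]|le_j].
      by rewrite ui_edge_ltE; lia.
    have le_A := area_fun_le j.
    have lt_i : i.-1 < m.+1 by have := ltn_ord i; lia.
    exists (Ordinal lt_i); rewrite ui_edge_ltE /=; lia.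
  by have := stepA j; lia.
by rewrite /=; lia.
Qed.

(** A peak-edge is determined by its right end. The free condition [C] serves both the peak count
    and the nesting. *)
Lemma card_peak_edges (C : pred nat) :
  #|[set e | peak_edge a e & C e.2]| =
  #|[set j : 'I_m.+1 | brk A j && C j]|.
Proof.
rewrite -(card_imset (f := fun j : 'I_m.+1 => (inord (j - A j) : 'I_m.+1, j)));
  last by move=> j j' [].
apply: eq_card => -[i j]; rewrite inE peak_edgeE.
apply/andP/imsetP => [[/andP[bj /eqP eq_j] Cj]|[j']].
  exists j; first by rewrite inE bj.
  by congr (_, _); apply/val_inj; rewrite /= inordK; have := ltn_ord j; lia.
rewrite inE => /andP[bj Cj] [-> ->]; rewrite bj Cj; split=> //=.
have le_A := area_fun_le j'; have lt_j := ltn_ord j'.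
by rewrite inordK; lia.
Qed.

Lemma peakE : peak a = (count (brk A) (iota 0 m)).+1.
Proof.
transitivity #|[set e | peak_edge a e & xpredT (val e.2)]|.
  by apply: eq_card => e; rewrite !inE andbT.
rewrite (card_peak_edges xpredT) cardE size_filter -enumT.
transitivity (count (brk A) (iota 0 m.+1)).
  by rewrite -val_enum_ord count_map; apply: eq_count => j; rewrite [LHS]inE andbT.
by rewrite -[m.+1]addn1 iotaD count_cat /= add0n brk_last addn0 addn1.
Qed.

Lemma peak_nestingE (v : 'I_m.+1) :
  peak_nesting a v = #|[set j : 'I_m.+1 | [&& brk A j, j <= v + A j & v <= j]]|.
Proof.
rewrite -(card_peak_edges (fun j => (j <= v + A j) && (v <= j))).
apply: eq_card => -[i j]; rewrite [in LHS]inE [in RHS]inE peak_edgeE.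
case: eqP => [eq_j|]; rewrite ?andbF // ?andbT inE /=.
by congr (_ && _); lia.
Qed.

(** If the run starting after [k] reached back to an earlier break [w], then [w] would lie in three
    peak-cliques: those ending at [w], at [k] and at the next break. *)
Lemma pnest_le2P :
  reflect (forall w k, w < k -> k < m -> brk A w -> brk A k -> w + A k.+1 <= k)
          (pnest a <= 2).
Proof.
rewrite /pnest; apply: (iffP (bigmax_leqP _ _ _)) => [nest w k lt_wk lt_km bw bk|sep v _].
  rewrite leqNgt; apply/negP => ge_w.
  (* The third clique ends at the first break [z] after [k]; the left end is constant from [k.+1] to
     [z]. *)
  have exz : exists z, (k < z) && brk A z by exists m; rewrite lt_km brk_last.
  case: (ex_minnP exz) => z /andP[lt_kz bz] min_z.
  have le_zm : z <= m by apply: min_z; rewrite lt_km brk_last.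
  have Az d : k.+1 + d <= z -> A (k.+1 + d) = A k.+1 + d.
    elim: d => [|d IHd] le_d; rewrite ?addn0 // !addnS.
    have lt_d : k.+1 + d < z by lia.
    rewrite -IHd; last exact: ltnW.
    apply/eqP/negPn/negP => nbd; have := min_z (k.+1 + d).
    by rewrite /brk nbd; lia.
  have := Az (z - k.+1); rewrite subnKC // => /(_ (leqnn z)) {}Az.
  have leA := area_fun_le; have mono := area_fun_mono (ltnW lt_kz).
  have lt_w : w < m.+1 by lia.
  have lt_k : k < m.+1 by lia.
  have lt_z : z < m.+1 by lia.
  have := nest (Ordinal lt_w) isT; rewrite peak_nestingE leqNgt => /card_gt2P[].
  exists (Ordinal lt_w), (Ordinal lt_k), (Ordinal lt_z).
  by rewrite !inE -!val_eqE /= bw bk bz; split; split; lia.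
rewrite peak_nestingE leqNgt; apply/card_gt2P => -[x [y [z [[]]]]].
rewrite !inE => /and3P[bx lex gex] /and3P[by_ ley gey] /and3P[bz lez gez].
rewrite -!val_eqE /= => -[ne_xy ne_yz ne_zx].
(* For right ends [i < j < l] of cliques containing [v], the run after [j] starts no later than the
   clique of [l], hence at or before [v <= i]. What follows sorts the three right ends. *)
have absurd (i j l : 'I_m.+1) : brk A i -> brk A j -> v <= i -> l <= v + A l ->
    i < j -> j < l -> False.
  move=> bi bj le_vi le_l lt_ij lt_jl; have := area_fun_mono lt_jl.
  by have := sep i j lt_ij (leq_trans lt_jl (ltn_ord l)) bi bj; lia.
have [lxy|lyx|/eqP] := ltngtP x y; last by rewrite (negPf ne_xy).
  have [lyz|lzy|/eqP] := ltngtP y z; last by rewrite (negPf ne_yz).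
    exact: (absurd x y z).
  have [lxz|lzx|/eqP] := ltngtP x z; last by rewrite eq_sym (negPf ne_zx).
    exact: (absurd x z y).
  exact: (absurd z x y).
have [lyz|lzy|/eqP] := ltngtP y z; last by rewrite (negPf ne_yz).
  have [lxz|lzx|/eqP] := ltngtP x z; last by rewrite eq_sym (negPf ne_zx).
    exact: (absurd y x z).
  exact: (absurd y z x).
exact: (absurd z y x).
Qed.

End AreaWord.

(** * Bijection between area sequences of nesting at most two and accepted words *)

Section Enumeration.
Local Open Scope nat_scope.

Definition N2_area (m : nat) : pred {ffun 'I_m.+1 -> 'I_m.+1} :=
  fun a => area_sequence a && (pnest a <= 2).

Lemma area_word_cons m (a : {ffun 'I_m.+1 -> 'I_m.+1}) :
  area_word a = area_fun a 0 :: [seq area_fun a i | i <- iota 1 m].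
Proof. by rewrite area_word_iota. Qed.

Lemma accept0P A m : A 0 = 0 ->
  reflect (forall k, k < m -> brk A k -> A k.+1 < gap A k)
          (accept 0 1 [seq A i | i <- iota 1 m]).
Proof.
move=> A0; rewrite -[X in accept X]A0 (acceptE A 0).
apply: (iffP allP) => good k.
  by move=> lt_km; apply/implyP/good; rewrite mem_iota.
by rewrite mem_iota => /good/implyP.
Qed.

(** An entry after a break lies below [gap A k <= (A k).+1], so acceptance already contains the step
    condition. *)
Lemma accept_step A m k : A 0 = 0 -> accept 0 1 [seq A i | i <- iota 1 m] ->
  k < m -> A k.+1 <= (A k).+1.
Proof.
move=> A0 /(accept0P _ A0) good lt_km; have := good k lt_km.
by have := gap_le A k; rewrite /brk; lia.
Qed.

Lemma N2_areaE m (a : {ffun 'I_m.+1 -> 'I_m.+1}) :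
  N2_area a = (area_fun a 0 == 0) &&
              accept 0 1 [seq area_fun a i | i <- iota 1 m].
Proof.
apply/andP/andP => [[area_a /(pnest_le2P area_a) sep]|[/eqP A0 acc]].
  have [A0 stepA] := area_sequenceP _ area_a.
  split; first exact/eqP; apply/(accept0P _ A0) => k lt_km bk.
  apply/(gapP stepA A0); last by move=> w lt_wk bw; exact: sep.
  by have := stepA k; move: bk; rewrite /brk; lia.
have stepA k : area_fun a k.+1 <= (area_fun a k).+1.
  have [lt_km|le_mk] := ltnP k m; last by rewrite area_fun_default.
  exact: accept_step A0 acc lt_km.
have area_a : area_sequence a by apply/area_sequenceP.
split=> //; apply/(pnest_le2P area_a) => w k lt_wk lt_km bw bk.
have /(gapP stepA A0) := accept0P _ A0 acc k lt_km bk.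
by apply=> //; have := stepA k; move: bk; rewrite /brk; lia.
Qed.

Lemma area_word_inj m : injective (@area_word m).
Proof.
move=> a b eq_ab; apply/ffunP => i; apply/val_inj.
by rewrite /= -!area_funE /area_fun eq_ab.
Qed.

Lemma perm_area_words m :
  perm_eq [seq area_word a | a <- enum (@N2_area m)]
          [seq 0 :: s | s <- words m 0 1].
Proof.
apply: uniq_perm.
- by rewrite map_inj_uniq ?enum_uniq //; exact: area_word_inj.
- by rewrite map_inj_uniq ?words_uniq // => ? ? [].
move=> s; apply/mapP/mapP => [[a]|[s' + ->]].
  rewrite mem_enum [_ \in _]N2_areaE => /andP[/eqP A0 acc] ->.
  exists [seq area_fun a i | i <- iota 1 m]; last by rewrite area_word_cons A0.
  by rewrite mem_words // size_map size_iota eqxx.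
rewrite mem_words // => /andP[/eqP sz_s' acc].
set A := nth 0 (0 :: s'); have A0 : A 0 = 0 by [].
have eq_s' : s' = [seq A i | i <- iota 1 m].
  by rewrite -[LHS](mkseq_nth 0) sz_s' (iotaDl 1 0) -map_comp.
rewrite eq_s' in acc.
(* This bound makes the [inord] in the definition of [a] exact. *)
have le_A k : k <= m -> A k <= k.
  elim: k => // k IHk lt_km; have := accept_step A0 acc lt_km.
  by have := IHk (ltnW lt_km); lia.
pose a := [ffun i : 'I_m.+1 => inord (A i) : 'I_m.+1].
have aA k : k <= m -> area_fun a k = A k.
  rewrite -ltnS => lt_km; rewrite -[k]/(val (Ordinal lt_km)) area_funE ffunE.
  by rewrite inordK //= (leq_ltn_trans (le_A k _)).
have eq_a : [seq area_fun a i | i <- iota 1 m] = [seq A i | i <- iota 1 m].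
  by apply/eq_in_map => i; rewrite mem_iota => /andP[_ lt_im]; apply: aA.
exists a; last by rewrite area_word_cons eq_a aA // -eq_s'.
by rewrite mem_enum [_ \in _]N2_areaE aA // eq_a.
Qed.

End Enumeration.

(** * Transfer matrix and recurrence *)

Section GeneratingFunction.
Variable R : comNzRingType.

Definition words_poly (m x g : nat) : {poly R} :=
  \sum_(s <- words m x g) 'X^(runs x s).

(** The factor ['X] accounts for the clique ending at the last vertex, which [runs] does not
    count. *)
Lemma PeakN2_words m : PeakN2 R m.+1 = 'X * words_poly m 0 1.
Proof.
transitivity (\sum_(w <- [seq area_word a | a <- enum (@N2_area m)])
                'X^((runs 0 (behead w)).+1) : {poly R}).
  rewrite big_map big_enum; apply: eq_big => [//|a].
  move=> /andP[area_a _]; have [A0 _] := area_sequenceP _ area_a.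
  congr 'X^_; rewrite peakE // area_word_cons /=.
  by rewrite -[X in runs X]A0 (runsE _ 0).
rewrite (perm_big _ (perm_area_words m)) big_map big_distrr /=.
by apply: eq_bigr => s _; rewrite exprS.
Qed.

Lemma words_polyS m x g : (g <= x.+1)%N ->
  words_poly m.+1 x g = words_poly m x.+1 g.+1
    + 'X * \sum_(y <- iota 0 g) words_poly m y (0 < y).+1.
Proof.
move=> le_gx; rewrite /words_poly /= big_cat big_map big_allpairs_dep /=.
congr (_ + _); first by apply: eq_bigr => s _; rewrite eqxx.
rewrite big_distrr /= !big_seq; apply: eq_bigr => y.
rewrite mem_iota add0n => /= lt_yg; rewrite big_distrr /=.
apply: eq_bigr => s _; rewrite -exprS.
by have -> : y != x.+1 by lia.
Qed.

(* Words from the state [(x, g)] are counted by a polynomial affine in [g]. *)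
Fixpoint affine_coefs (m : nat) : {poly R} * {poly R} :=
  if m is m'.+1 then
    let: (u, v) := affine_coefs m' in
    (u + (1 - 'X) * v, 'X * u + (1 + 2 * 'X) * v)
  else (1, 0).

Lemma words_poly_affine m x g : (0 < g <= x.+1)%N ->
  words_poly m x g = (affine_coefs m).1 + (affine_coefs m).2 *+ g.
Proof.
elim: m x g => [|m IHm] x g /andP[lt_0g le_gx].
  by rewrite /words_poly big_seq1 mul0rn addr0.
rewrite words_polyS // IHm ?ltnS ?le_gx //=.
(* The entry [0] leads to gap [1] and every positive entry to gap [2], so the positive entries all
   contribute the same term. *)
case: g lt_0g le_gx => // g _ le_gx; rewrite big_cons IHm //.
rewrite (eq_big_seq (fun=> (affine_coefs m).1 + (affine_coefs m).2 *+ 2)); last first.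
  by move=> y; rewrite mem_iota => /andP[lt_0y _]; rewrite lt_0y IHm.
rewrite big_const_seq count_predT size_iota iter_addr_0.
case: (affine_coefs m) => u v /=; ring.
Qed.

Definition factor_N2 (m : nat) : {poly R} :=
  (affine_coefs m).1 + (affine_coefs m).2.

Lemma PeakN2_factor m : PeakN2 R m.+1 = 'X * factor_N2 m.
Proof. by rewrite PeakN2_words words_poly_affine. Qed.

Lemma factor_N2_0 : factor_N2 0 = 1.
Proof. by rewrite /factor_N2 addr0. Qed.

Lemma factor_N2_1 : factor_N2 1 = 1 + 'X.
Proof. by rewrite /factor_N2 /=; ring. Qed.

(** Cayley-Hamilton for the matrix of one step of [affine_coefs], applied to the linear form
    [u + v]. *)
Lemma factor_N2_rec m : factor_N2 m.+2 =
  2 * ('X + 1) * factor_N2 m.+1 - (1 + 'X + 'X^2) * factor_N2 m.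
Proof. by rewrite /factor_N2 /=; case: (affine_coefs m) => u v /=; ring. Qed.

Lemma PeakN2_rec n : (3 <= n)%N ->
  PeakN2 R n = 2 * ('X + 1) * PeakN2 R (n - 1)
               - (1 + 'X + 'X^2) * PeakN2 R (n - 2).
Proof.
case: n => [|[|[|n]]] // _; rewrite !subSS !subn0 !PeakN2_factor.
by rewrite factor_N2_rec; ring.
Qed.

End GeneratingFunction.

(** * Degree, leading coefficient and value at zero *)

Section FactorCoefficients.
Variable R : comNzRingType.

(** In top degree the recurrence reads [2 * 1 - 1 = 1], which a two-step induction propagates. *)
Lemma factor_N2_coef m :
  (factor_N2 R m)`_m = 1 /\ forall i, (m < i)%N -> (factor_N2 R m)`_i = 0.
Proof.
have [n le_mn] := ubnP m; elim: n m le_mn => // n IHn [|[|m]] lt_mn.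
- by rewrite factor_N2_0; split=> [|i lt_0i]; rewrite coef1 // gtn_eqF.
- rewrite factor_N2_1; split=> [|[|[|i]]] //; first by rewrite coefD coef1 coefX add0r.
  by move=> _; rewrite coefD coef1 coefX addr0.
have [c1 z1] := IHn m.+1 lt_mn; have [c0 z0] := IHn m (ltnW lt_mn).
(* The shift to [i.+2] keeps the multiplications by ['X] away from the constant coefficient. *)
have recE i : (factor_N2 R m.+2)`_i.+2 =
    2 * (factor_N2 R m.+1)`_i.+1 + 2 * (factor_N2 R m.+1)`_i.+2
    - (factor_N2 R m)`_i.+2 - (factor_N2 R m)`_i.+1 - (factor_N2 R m)`_i.
  have -> : factor_N2 R m.+2 =
    (factor_N2 R m.+1 * 'X) *+ 2 + factor_N2 R m.+1 *+ 2 - factor_N2 R m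
      - factor_N2 R m * 'X - factor_N2 R m * 'X * 'X.
    by rewrite factor_N2_rec; ring.
  by rewrite !(coefB, coefD, coefMn, coefMX) /=; ring.
split=> [|[|[|i]] // lt_mi]; rewrite recE.
  by rewrite c1 c0 z1 // !z0 //; ring.
by rewrite !z1 ?z0 //; first ring; lia.
Qed.

Lemma factor_N2_rec_horner m x : (factor_N2 R m.+2).[x] =
  2 * (x + 1) * (factor_N2 R m.+1).[x] - (1 + x + x ^+ 2) * (factor_N2 R m).[x].
Proof. by rewrite factor_N2_rec; move: (factor_N2 R _) => p; rewrite !hornerE. Qed.

Lemma factor_N2_horner0 m : (factor_N2 R m).[0] = 1.
Proof.
have [n le_mn] := ubnP m; elim: n m le_mn => // n IHn [|[|m]] lt_mn.
- by rewrite factor_N2_0 hornerE.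
- by rewrite factor_N2_1 !hornerE.
rewrite factor_N2_rec_horner (IHn m.+1) // (IHn m (ltnW lt_mn)); ring.
Qed.

Lemma size_factor_N2 m : size (factor_N2 R m) = m.+1.
Proof.
have [c z] := factor_N2_coef m; apply/eqP; rewrite eqn_leq; apply/andP; split.
  exact/leq_sizeP.
by rewrite ltnNge; apply/negP => /leq_sizeP/(_ m (leqnn m))/eqP; rewrite c oner_eq0.
Qed.

Lemma factor_N2_monic m : factor_N2 R m \is monic.
Proof.
by rewrite monicE lead_coefE size_factor_N2; apply/eqP; case: (factor_N2_coef m).
Qed.

End FactorCoefficients.

(** * Locating zeros by sign changes *)

Section Interlacing.
Variable R : rcfType.

Definition prod_XsubC (s : seq R) : {poly R} := \prod_(x <- s) ('X - x%:P).

(** Exactly the first [i] factors are negative at [x]. *)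
Lemma sign_prod_XsubC (s : seq R) i x : (i <= size s)%N ->
    (forall j, (j < i)%N -> x < s`_j) ->
    (forall j, (i <= j < size s)%N -> s`_j < x) ->
  0 < (-1) ^+ i * (prod_XsubC s).[x].
Proof.
rewrite /prod_XsubC; elim: s i => [|y s IHs] i.
  by rewrite leqn0 => /eqP -> _ _; rewrite big_nil expr0 mul1r hornerE ltr01.
rewrite big_cons hornerM hornerXsubC; case: i => [_ _ gt_s|i lt_is lt_s gt_s].
  rewrite mulrCA mulr_gt0 ?subr_gt0 ?(gt_s 0%N) //.
  by apply: IHs => // j lt_j; apply: (gt_s j.+1).
set P := \prod_(_ <- s) _.
have -> : (-1) ^+ i.+1 * ((x - y) * P.[x]) = (y - x) * ((-1) ^+ i * P.[x]).
  by rewrite exprS; ring.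
rewrite mulr_gt0 ?subr_gt0 ?(lt_s 0%N) //.
by apply: IHs => // j lt_j; [apply: (lt_s j.+1)|apply: (gt_s j.+1)].
Qed.

Lemma sign_minfty (p : {poly R}) (b : R) : p \is monic ->
  exists2 y, y < b & 0 < (-1) ^+ (size p).-1 * p.[y].
Proof.
move=> mon_p; set k := (size p).-1.
(* Reflecting [p] turns its behaviour at -oo into that of a monic polynomial at +oo. *)
pose q := (-1) ^+ k *: (p \Po - 'X).
have lc_q : lead_coef q = 1.
  rewrite /q lead_coefZ lead_coef_comp ?size_polyN ?size_polyX //.
  by rewrite (eqP mon_p) mul1r lead_coefN lead_coefX -exprMn mulrNN mulr1 expr1n.
have [|c le_q] := @poly_pinfty_gt_lc _ q; first by rewrite lc_q.
exists (- Num.max c (1 - b)).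
  by rewrite ltrNl lt_max orbC ltrDr ltr01.
have := le_q (Num.max c (1 - b)); rewrite le_max lexx => /(_ isT).
rewrite lc_q /q hornerZ horner_comp !hornerE; exact: lt_le_trans.
Qed.

(** The strict chain [0 > r_0 > s_0 > r_1 > s_1 > ...], ending in [r]; putting [0] before [s]
    includes the bound [r_0 < 0]. *)
Definition interlaced (s r : seq R) : Prop :=
  [/\ size r = (size s).+1,
      forall i, (i < size r)%N -> r`_i < (0 :: s)`_i &
      forall i, (i < size s)%N -> s`_i < r`_i].

Lemma interlaced_sorted s r : interlaced s r -> sorted >%R (0 :: r).
Proof.
case=> sz_r lt_rs lt_sr; apply/(sortedP 0) => -[_|i lt_ir] /=.
  by apply: (lt_rs 0%N); rewrite sz_r.
have /= lt1 := lt_rs i.+1 lt_ir; apply: lt_trans lt1 (lt_sr i _).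
by rewrite -ltnS -sz_r.
Qed.

(** The sign changes yield as many distinct zeros as the degree of [p], so [p] splits over them. *)
Lemma exists_interlaced (p : {poly R}) (s : seq R) :
    p \is monic -> size p = (size s).+2 -> sorted >%R (0 :: s) ->
    (forall i, (i <= size s)%N -> 0 < (-1) ^+ i * p.[(0 :: s)`_i]) ->
  exists2 r, p = prod_XsubC r & interlaced s r.
Proof.
move=> mon_p sz_p /(sortedP 0) dec_s sgn_p.
have [y lt_y sgn_y] := sign_minfty (last 0 s) mon_p.
(* The cut points in decreasing order, with [y] standing for -oo. *)
pose c := 0 :: rcons s y.
have cE i : (i <= size s)%N -> c`_i = (0 :: s)`_i.
  by move=> le_is; rewrite /c -rcons_cons nth_rcons ltnS le_is.
have cy : c`_(size s).+1 = y by rewrite /c /= nth_rcons ltnn eqxx.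
have lt_c i : (i <= size s)%N -> c`_i.+1 < c`_i.
  rewrite leq_eqVlt => /predU1P[->|lt_is]; last first.
    by rewrite !cE ?(ltnW lt_is) //; exact: dec_s.
  by rewrite cy cE // (nth_last 0 (0 :: s)).
have sgn_c i : (i <= (size s).+1)%N -> 0 < (-1) ^+ i * p.[c`_i].
  rewrite leq_eqVlt => /predU1P[->|lt_is]; last by rewrite cE ?sgn_p.
  by rewrite cy; move: sgn_y; rewrite sz_p.
have ivt (i : 'I_(size s).+1) : {x | c`_i.+1 < x < c`_i & root p x}.
  have le_i := ltn_ord i; rewrite ltnS in le_i.
  have [||x] := @poly_ivtoo _ p c`_i.+1 c`_i; first by rewrite ltW ?lt_c.
    have := mulr_gt0 (sgn_c i.+1 le_i) (sgn_c i (leqW le_i)).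
    rewrite mulrACA -exprD addSn addnn exprS -muln2 exprM sqrr_sign mulr1.
    by rewrite mulN1r oppr_gt0.
  by rewrite itv_boundlr => lt_x rt_x; exists x.
pose r := [seq s2val (ivt i) | i <- enum 'I_(size s).+1].
have sz_r : size r = (size s).+1 by rewrite size_map size_enum_ord.
have rP i : (i < size r)%N -> c`_i.+1 < r`_i < c`_i.
  rewrite sz_r => lt_i; rewrite /r (nth_map (Ordinal lt_i)) ?size_enum_ord //.
  rewrite (nth_ord_enum _ (Ordinal lt_i)).
  exact: (s2valP (ivt (Ordinal lt_i))).
have int_sr : interlaced s r.
  split=> // i lt_i.
    by have /andP[_] := rP i lt_i; rewrite cE // -ltnS -sz_r.
  have lt_ir : (i < size r)%N by rewrite sz_r ltnW.
  by have /andP[+ _] := rP i lt_ir; rewrite cE.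
exists r => //; rewrite [LHS](@all_roots_prod_XsubC _ p r).
- by rewrite (eqP mon_p) scale1r.
- by rewrite sz_p sz_r.
- by apply/allP => x /mapP[i _ ->]; exact: (s2valP' (ivt i)).
rewrite uniq_rootsE; have := interlaced_sorted int_sr => /path_sorted.
by apply: sorted_uniq; [exact: rev_trans lt_trans|exact: ltxx].
Qed.

(** Exactly [i] entries of [s] exceed [r_i]. *)
Lemma interlaced_sign s r i : interlaced s r -> (i < size r)%N ->
  0 < (-1) ^+ i * (prod_XsubC s).[r`_i].
Proof.
move=> int_sr lt_ir; have [sz_r lt_rs lt_sr] := int_sr.
have := interlaced_sorted int_sr => /path_sorted dec_r.
have le_r j k : (j <= k < size r)%N -> r`_k <= r`_j.
  move=> /andP[le_jk lt_k]; apply: (sorted_leq_nth (rev_trans le_trans) lexx 0) => //.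
  - by apply: sub_sorted dec_r => x y; exact: ltW.
  - exact: leq_ltn_trans lt_k.
apply: sign_prod_XsubC => [|j lt_ji|j /andP[le_ij lt_js]].
- by rewrite -ltnS -sz_r.
- have /= lt_j := lt_rs j.+1 (leq_ltn_trans lt_ji lt_ir).
  by apply: le_lt_trans lt_j; rewrite le_r // lt_ji.
- apply: (lt_le_trans (lt_sr j lt_js)); rewrite le_r // le_ij sz_r.
  exact: ltnW.
Qed.

Lemma factor_N2_roots m : exists s r,
  [/\ size s = m, factor_N2 R m = prod_XsubC s,
      factor_N2 R m.+1 = prod_XsubC r & interlaced s r].
Proof.
elim: m => [|m [s [r [sz_s fs fr int_sr]]]].
  exists [::], [:: -1]; split=> //.
  - by rewrite factor_N2_0 /prod_XsubC big_nil.
  - by rewrite factor_N2_1 /prod_XsubC big_seq1 polyCN opprK addrC.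
  - by split=> // -[|//] _ /=; rewrite oppr_lt0 ltr01.
have [sz_r _ _] := int_sr.
have [||||r' fr' int_rr'] := @exists_interlaced (factor_N2 R m.+2) r.
- exact: factor_N2_monic.
- by rewrite size_factor_N2 sz_r sz_s.
- exact: interlaced_sorted int_sr.
(* Position [i.+1] of [0 :: r] holds [r_i]; this shift of the exponent absorbs the minus sign of the
   recurrence. *)
- case=> [_|i lt_ir] /=; first by rewrite factor_N2_horner0 mulr1 ltr01.
  have rt_i : (factor_N2 R m.+1).[r`_i] = 0.
    by apply/eqP; rewrite fr [_ == 0]root_prod_XsubC mem_nth.
  have := interlaced_sign int_sr lt_ir; rewrite -fs.
  rewrite factor_N2_rec_horner rt_i mulr0 sub0r.
  set x := r`_i; set z := _.[x] => gt0.
  have -> : (-1) ^+ i.+1 * - ((1 + x + x ^+ 2) * z) =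
            (1 + x + x ^+ 2) * ((-1) ^+ i * z) by rewrite exprS; ring.
  by apply: mulr_gt0 gt0; nra.
by exists r, r'; split; rewrite // sz_r sz_s.
Qed.

End Interlacing.

(** * Real-rootedness and the Sturm property *)

Section Sturm.
Variable R : realType.

Lemma real_rooted_prod_XsubC (s : seq R) : real_rooted (prod_XsubC s).
Proof.
right=> z; rewrite /prod_XsubC rmorph_prod /=.
under eq_bigr do rewrite map_polyXsubC.
rewrite -(big_map (real_complex R) predT (fun x => 'X - x%:P)) root_prod_XsubC.
by case/mapP => x _ ->.
Qed.

Lemma decreasing_zeros_prod_XsubC (s : seq R) :
  sorted >%R s -> decreasing_zeros (prod_XsubC s) s.
Proof.
move=> dec_s; split=> [|x]; last by rewrite mu_prod_XsubC.
by apply: sub_sorted dec_s => x y; exact: ltW.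
Qed.

Lemma lead_coef_prod_XsubC (s : seq R) : lead_coef (prod_XsubC s) = 1.
Proof. exact/eqP/monic_prod_XsubC. Qed.

Lemma PeakN2_prod_XsubC m s : factor_N2 R m = prod_XsubC s ->
  PeakN2 R m.+1 = prod_XsubC (0 :: s).
Proof. by move=> fs; rewrite PeakN2_factor fs /prod_XsubC big_cons subr0. Qed.

Lemma real_rooted_PeakN2 n : real_rooted (PeakN2 R n) /\ 0 < lead_coef (PeakN2 R n).
Proof.
case: n => [|n]; first by rewrite lead_coef1; split; [left; rewrite size_poly1|].
have [s [_ [_ /PeakN2_prod_XsubC -> _ _]]] := factor_N2_roots R n.
by rewrite lead_coef_prod_XsubC; split=> //; exact: real_rooted_prod_XsubC.
Qed.

Lemma size_PeakN2 n : size (PeakN2 R n) = n.+1.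
Proof.
case: n => [|n]; first exact: size_poly1.
rewrite PeakN2_factor mulrC size_mulX ?size_factor_N2 //.
by rewrite -size_poly_eq0 size_factor_N2.
Qed.

Lemma interlaces_PeakN2 n : interlaces (PeakN2 R n) (PeakN2 R n.+1).
Proof.
split; try exact: real_rooted_PeakN2.
(* The polynomial of index [0] is [1] and lacks the factor ['X], so it is treated apart. *)
case: n => [|n].
  exists [::], [:: 0]; split=> // [|]; last first.
    rewrite (@PeakN2_prod_XsubC 0 [::]); first exact: decreasing_zeros_prod_XsubC.
    by rewrite factor_N2_0 /prod_XsubC big_nil.
  have -> : PeakN2 R 0 = prod_XsubC [::] by rewrite /prod_XsubC big_nil.
  exact: decreasing_zeros_prod_XsubC.
have [s [r [_ fs fr int_sr]]] := factor_N2_roots R n.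
have dec_r := interlaced_sorted int_sr; have [sz_r lt_rs lt_sr] := int_sr.
have dec_s : sorted >%R (0 :: s).
  apply/(sortedP 0) => i lt_is; case: i lt_is => [|i] lt_is /=.
    by apply: (lt_trans (lt_sr 0%N lt_is)); apply: (lt_rs 0%N); rewrite sz_r.
  apply: (lt_trans (lt_sr i.+1 lt_is)); apply: (lt_rs i.+1).
  by rewrite sz_r ltnW.
(* Both polynomials have largest zero [0], a tie that the weak inequalities allow; below it the
   zeros interlace strictly. *)
exists (0 :: s), (0 :: r); rewrite (PeakN2_prod_XsubC fs) (PeakN2_prod_XsubC fr).
split; try exact: decreasing_zeros_prod_XsubC.
- by rewrite /= sz_r !ltnS leqnSn leqnn.
- by case=> [//|i] /= lt_is; apply/ltW/lt_sr.
- by move=> i lt_ir; apply/ltW/lt_rs.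
Qed.

End Sturm.

Theorem corollary5p7 (R : realType) :
  [/\ PeakN2 R 1 = 'X,
      PeakN2 R 2 = 'X + 'X^2,
      forall n : nat, (3 <= n)%N ->
        PeakN2 R n = 2 * ('X + 1) * PeakN2 R (n - 1)
                     - (1 + 'X + 'X^2) * PeakN2 R (n - 2),
      forall n : nat, real_rooted (PeakN2 R n) &
      Sturm_sequence (PeakN2 R)].
Proof.
split.
- by rewrite PeakN2_factor factor_N2_0 mulr1.
- by rewrite PeakN2_factor factor_N2_1 mulrDr mulr1 expr2.
- exact: PeakN2_rec.
- by move=> n; case: (real_rooted_PeakN2 R n).
split; [exact: real_rooted_PeakN2|exact: interlaces_PeakN2|exact: size_PeakN2].
Qed.
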